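(* Let $G=(V,E,\mu,\kappa)$ be a finite connected undirected graph with positive vertex masses $\mu$ and positive edge conductances $\kappa$, and let $S$ be a proper nonempty subset of $V$. Let $\lambda(G,S)$ be the Dirichlet eigenvalue and $\Psi(G,S)$ the Dirichlet content of $G$ with boundary set $S$. Then $$\frac{\Psi}{4}\le \lambda\le \Psi.$$
   Context: Let $L$ be the Laplacian of $G$, with quadratic form $x^\top Lx=\sum_{(u,v)\in E}\kappa_{(u,v)}(x_u-x_v)^2$, and let $M=\mathrm{diag}(\mu)$ be the diagonal mass matrix. The Dirichlet eigenvalue is $\lambda(G,S)=\min\{\frac{x^\top Lx}{x^\top Mx} : x\in\mathbb{R}^V,\ x|_S=0,\ x\neq 0\}$. For $A\subseteq V$, $\mu(A)=\sum_{v\in A}\mu_v$. For disjoint nonempty $A,B\subseteq V$, the effective resistance $R(A,B)$ is defined by $\frac{1}{R(A,B)}=\min\{x^\top Lx : x\in\mathbb{R}^V,\ x|_A=1,\ x|_B=0\}$. The Dirichlet content is $\Psi(G,S)=\min\{\frac{R(S,A)^{-1}}{\mu(A)} : A\subseteq V,\ A\neq\emptyset,\ A\cap S=\emptyset\}$. *)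

(* Defs.v *)
From HB Require Import structures.
From mathcomp Require Import all_boot all_order all_algebra.
From mathcomp Require Import all_classical all_reals.
From mathcomp Require Import ring lra.

Set Implicit Arguments.
Unset Strict Implicit.
Unset Printing Implicit Defensive.

Import Order.TTheory GRing.Theory Num.Theory.

Local Open Scope ring_scope.

Record wgraph (R : realType) (V : finType) := WGraph {
  adj : rel V ;
  adj_sym : symmetric adj ;
  adj_irr : irreflexive adj ;
  mass : V -> R ;
  mass_gt0 : forall v, 0 < mass v ;
  (* only the values of [cond] on adjacent pairs are ever used *)
  cond : V -> V -> R ;
  cond_sym : forall u v, cond u v = cond v u ;
  cond_gt0 : forall u v, adj u v -> 0 < cond u v }.

Section Definitions.
Context {R : realType} {V : finType}.
Implicit Types (G : wgraph R V) (A B S : {set V}) (x : V -> R).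

Definition connected_graph G : Prop := forall u v, connect (adj G) u v.

(* Square matrices and vectors indexed by the finite type [V]. *)
Definition laplacian G (u v : V) : R :=
  if u == v then \sum_(w | adj G u w) cond G u w
  else if adj G u v then - cond G u v else 0.

Definition mass_matrix G (u v : V) : R := if u == v then mass G u else 0.

Definition qform (Q : V -> V -> R) x : R := \sum_u \sum_v x u * Q u v * x v.

Definition is_minimum (E : set R) (m : R) : Prop :=
  E m /\ forall y, E y -> m <= y.

(* The minimum of [E]; [0] if [E] has none. *)
Definition minimum (E : set R) : R := xget 0 [set m | is_minimum E m]%classic.

Definition dirichlet_eigenvalue G S : R :=
  minimum [set r : R | exists x : V -> R,
    [/\ forall v, v \in S -> x v = 0, x <> (fun=> 0)
      & r = qform (laplacian G) x / qform (mass_matrix G) x]]%classic.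

Definition mu G A : R := \sum_(v in A) mass G v.

Definition effective_resistance G A B : R :=
  (minimum [set r : R | exists x : V -> R,
    [/\ forall v, v \in A -> x v = 1, forall v, v \in B -> x v = 0
      & r = qform (laplacian G) x]]%classic)^-1.

Definition dirichlet_content G S : R :=
  minimum [set r : R | exists A : {set V},
    [/\ A != finset.set0, [disjoint A & S]%B
      & r = (effective_resistance G S A)^-1 / mu G A]]%classic.

Lemma minimumE (E : set R) m : is_minimum E m -> minimum E = m.
Proof.
move=> Em; have [E1 E2] : is_minimum E (minimum E) by apply: (xgetPex 0 (P := [set m | is_minimum E m]%classic)); exists m.
by apply: le_anti; apply/andP; split; [exact/E2/(proj1 Em) | exact: (proj2 Em)].
Qed.

Lemma qform_mass G x : qform (mass_matrix G) x = \sum_v mass G v * x v ^+ 2.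
Proof.
apply: eq_bigr => u _; rewrite (bigD1 u)//= big1 ?addr0.
  by rewrite /mass_matrix eqxx; ring.
by move=> v /negbTE nvu; rewrite /mass_matrix eq_sym nvu; ring.
Qed.

(* The ordering by [enum_rank] picks each undirected edge exactly once. *)
Lemma qform_laplacian G x :
  qform (laplacian G) x =
  \sum_(p : V * V | adj G p.1 p.2 && (enum_rank p.1 < enum_rank p.2)%N)
     cond G p.1 p.2 * (x p.1 - x p.2) ^+ 2.
Proof.
pose F u v := cond G u v * (x u * (x u - x v)).
have -> : qform (laplacian G) x = \sum_(p : V * V | adj G p.1 p.2) F p.1 p.2.
  rewrite -(pair_big_dep xpredT (adj G) F); apply: eq_bigr => u _ /=.
  rewrite (bigD1 u)//= {1}/laplacian eqxx.
  rewrite [X in _ + X](eq_bigr (fun v =>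
    if adj G u v then - (cond G u v * x u * x v) else 0)).
    rewrite -big_mkcondr [X in _ + X](eq_bigl (adj G u)) /=; last first.
      by move=> v /=; have [->|] := eqVneq v u; rewrite ?(adj_irr G).
    rewrite mulr_sumr mulr_suml -big_split; apply: eq_bigr => v _ /=.
    by rewrite /F; ring.
  move=> v /negbTE nvu; rewrite /laplacian eq_sym nvu.
  by case: ifP => _; ring.
rewrite (bigID (fun p : V * V => (enum_rank p.1 < enum_rank p.2)%N)) /=.
rewrite [X in _ + X](reindex_inj (h := fun p : V * V => (p.2, p.1))) /=; last first.
  by move=> [a b] [c d] [-> ->].
rewrite [X in _ + X](eq_bigl
  (fun p => adj G p.1 p.2 && (enum_rank p.1 < enum_rank p.2)%N)); last first.
  move=> [u v] /=; rewrite (adj_sym G v u) -leqNgt leq_eqVlt.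
  case: eqP => [/ord_inj/enum_rank_inj ->|//].
  by rewrite (adj_irr G).
rewrite -big_split; apply: eq_bigr => -[u v] _ /=.
by rewrite /F (cond_sym G v u); ring.
Qed.

End Definitions.

(* Main.v *)
(** Upper bound: the potential of a set [A] disjoint from [S] (equal to [1] on [A]
and [0] on [S], of least energy) is a test function for the eigenvalue, and its
weighted square norm is at least [mu A].

Lower bound, after Hansson's proof of the strong capacitary inequality: let
[x >= 0] vanish on [S] and have levels [0 = t_0 <= t_1 <= ... <= t_k]; let [p_i]
be the potential of [A_i = {x > t_i}], [c_i] its energy, and
[P = \sum_i (t_(i+1) - t_i) p_i].  Since [E(p_i, z) >= a c_i] as soon as
[z >= a] on [A_i] and [z = 0] on [S], with equality if [z = a] on [A_i], one gets
[E(P, P) = \sum_i (t_(i+1)^2 - t_i^2) c_i =: Q] and [E(x, P) >= Q / 2], hence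
[Q <= 4 E(x, x)].  As [Psi mu(A_i) <= c_i], the layer-cake formula gives
[Psi \sum_v mu_v x_v^2 <= Q].  Minimisers exist by compactness of boxes. *)

Require Import Defs.
From HB Require Import structures.
From mathcomp Require Import all_boot all_order all_algebra.
From mathcomp Require Import all_classical all_reals.
From mathcomp Require Import topology normedtype derive.
From mathcomp Require Import ring lra.

Set Implicit Arguments.
Unset Strict Implicit.
Unset Printing Implicit Defensive.

Import Order.TTheory GRing.Theory Num.Theory.
Import numFieldNormedType.Exports.

Local Open Scope ring_scope.

(** * Minimisers of coercive continuous functions *)

Section Minimisation.
Context {R : realType} {V : finType}.
Implicit Types (f : {ptws V -> R} -> R) (C : set {ptws V -> R}).
Local Open Scope classical_set_scope.

Lemma continuous_coord (v : V) : continuous (fun x : {ptws V -> R} => x v).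
Proof. exact: (@proj_continuous V (fun=> R) v). Qed.

Lemma continuous_sumr (I : Type) (r : seq I) (P : pred I)
    (F : I -> {ptws V -> R} -> R) :
  (forall i, P i -> continuous (F i)) ->
  continuous (fun x => \sum_(i <- r | P i) F i x).
Proof. by apply: continuous_big; exact: add_continuous. Qed.

Lemma continuous_qform (Q : V -> V -> R) :
  continuous (qform Q : {ptws V -> R} -> R).
Proof.
apply: continuous_sumr => u _; apply: continuous_sumr => v _ x.
apply: (@continuousM R {ptws V -> R} (fun y => y u * Q u v) (fun y => y v)).
  apply: (@continuousM R {ptws V -> R} (fun y => y u) (fun=> Q u v)).
    exact: continuous_coord.
  exact: cst_continuous.
exact: continuous_coord.
Qed.

Lemma closed_level f (c : R) : continuous f -> closed [set x | f x = c].
Proof.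
move=> cf; apply: (@preimage_closed _ _ f [set c]) => [x _|]; first exact: cf.
exact: closed_eq.
Qed.

Lemma closed_coord_eq (B : {set V}) (c : R) :
  closed [set x : {ptws V -> R} | forall v, v \in B -> x v = c].
Proof.
have -> : [set x : {ptws V -> R} | forall v, v \in B -> x v = c] =
    \bigcap_(v in [set v | v \in B]) [set x | x v = c] by [].
by apply: closed_bigI => v _; apply: closed_level; exact: continuous_coord.
Qed.

(** The points of [C] with value at most [f x0] lie in a box, compact by Tychonoff; all other points
    of [C] have a larger value. *)
Lemma coercive_minimizer f C (x0 : V -> R) (K : R) :
  continuous f -> closed C -> C x0 ->
  (forall x, C x -> f x <= f x0 -> forall v, `|x v| <= K) ->
  exists2 m, C m & forall x, C x -> f m <= f x.
Proof.
move=> cf clC Cx0 bdd.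
pose B := [set x : {ptws V -> R} | forall v, `[- K, K] (x v)].
have cB : compact B by apply: (tychonoff (fun=> @segment_compact _ _ _)).
have B0 : B x0.
  by move=> v; rewrite /= in_itv /= -ler_norml; apply: bdd.
have [|||m /set_mem[Bm Cm] mP] :=
    @compact_EVT_min _ R f (B `&` C).
- by exists x0.
- exact: compact_closedI.
- exact: continuous_subspaceT.
exists m => // x Cx; have [lex|ltx] := leP (f x) (f x0).
  apply: mP; apply/mem_set; split => // v.
  by rewrite /= in_itv /= -ler_norml; apply: bdd.
by apply: le_trans (ltW ltx); apply: mP; apply/mem_set.
Qed.

End Minimisation.

(** * The Dirichlet form and the mass norm *)

Section Energy.
Context {R : realType} {V : finType} (G : wgraph R V).
Implicit Types (x y z : V -> R) (A B S : {set V}).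

(** The bilinear form polarising the Laplacian quadratic form. *)
Definition dirichlet_form x y : R :=
  \sum_(e : V * V | adj G e.1 e.2 && (enum_rank e.1 < enum_rank e.2)%N)
     cond G e.1 e.2 * ((x e.1 - x e.2) * (y e.1 - y e.2)).

Local Notation "''E' ( x , y )" := (dirichlet_form x y)
  (at level 0, format "''E' ( x ,  y )").

Lemma qform_dirichlet x : qform (laplacian G) x = 'E(x, x).
Proof. by rewrite qform_laplacian; apply: eq_bigr => e _; rewrite expr2. Qed.

Lemma dirichletC x y : 'E(x, y) = 'E(y, x).
Proof. by apply: eq_bigr => e _; rewrite [X in _ * X]mulrC. Qed.

Lemma dirichletD a x y z :
  'E(z, fun v => x v + a * y v) = 'E(z, x) + a * 'E(z, y).
Proof.
by rewrite mulr_sumr -big_split; apply: eq_bigr => e _ /=; ring.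
Qed.

Lemma dirichletZ a x y : 'E(y, fun v => a * x v) = a * 'E(y, x).
Proof. by rewrite mulr_sumr; apply: eq_bigr => e _ /=; ring. Qed.

Lemma dirichlet_ge0 x : 0 <= 'E(x, x).
Proof.
apply: sumr_ge0 => e /andP[ee _].
by rewrite mulr_ge0 ?(ltW (cond_gt0 ee))// -expr2 sqr_ge0.
Qed.

Lemma dirichlet_sqrD a x y :
  'E(fun v => x v + a * y v, fun v => x v + a * y v) =
  'E(x, x) + 2 * a * 'E(x, y) + a ^+ 2 * 'E(y, y).
Proof.
rewrite dirichletD dirichletC dirichletD [X in _ + a * X]dirichletC dirichletD.
by rewrite (dirichletC y x); ring.
Qed.

(** A 1-Lipschitz map shrinks every edge difference. It serves for truncation at 1 and for the
    absolute value. *)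
Lemma dirichlet_contraction (f : R -> R) x :
  (forall a b, `|f a - f b| <= `|a - b|) ->
  'E(fun v => f (x v), fun v => f (x v)) <= 'E(x, x).
Proof.
move=> fP; apply: ler_sum => e /andP[ee _].
rewrite ler_pM2l ?(cond_gt0 ee)// -!expr2.
by rewrite -real_normK ?num_real// -[leRHS]real_normK ?num_real// lerXn2r ?nnegrE.
Qed.

Lemma dirichlet_flip x :
  'E(fun v => 1 - x v, fun v => 1 - x v) = 'E(x, x).
Proof. by apply: eq_bigr => e _; ring. Qed.

(** Every edge term vanishes, so [x] is constant along paths. *)
Lemma dirichlet_eq0 x : connected_graph G -> 'E(x, x) = 0 ->
  forall u v, x u = x v.
Proof.
move=> conG /eqP; rewrite psumr_eq0; last first.
  move=> e /andP[ee _].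
  by rewrite mulr_ge0 ?(ltW (cond_gt0 ee))// -expr2 sqr_ge0.
move=> /allP E0.
have step_lt u v : adj G u v -> (enum_rank u < enum_rank v)%N -> x u = x v.
  move=> uv ltuv; have := E0 (u, v) (mem_index_enum _).
  rewrite /= uv ltuv /= mulf_eq0 (gt_eqF (cond_gt0 uv)) /= mulf_eq0 orbb.
  by rewrite subr_eq0 => /eqP.
have step u v : adj G u v -> x u = x v.
  move=> uv; case: (ltngtP (enum_rank u) (enum_rank v)).
  - exact: step_lt.
  - by move=> vu; apply/esym/step_lt => //; rewrite adj_sym.
  - by move=> /ord_inj/enum_rank_inj ->.
move=> u v; have /connectP[p up ->] := conG u v.
by elim: p u up => //= w p IHp u /andP[/step -> /IHp].
Qed.

Definition sqmass x : R := qform (mass_matrix G) x.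

Lemma sqmassE x : sqmass x = \sum_v mass G v * x v ^+ 2.
Proof. exact: qform_mass. Qed.

Lemma sqmass_ge x v : mass G v * x v ^+ 2 <= sqmass x.
Proof.
rewrite sqmassE (bigD1 v)//= lerDl sumr_ge0// => u _.
by rewrite mulr_ge0 ?sqr_ge0 ?(ltW (mass_gt0 _ _)).
Qed.

Lemma sqmass_gt0 x : x <> (fun=> 0) -> 0 < sqmass x.
Proof.
move=> x0; have [v xv] : exists v, x v != 0.
  apply: contra_notP x0 => /forallNP xP; apply/funext => v.
  exact/eqP/negPn/negP/xP.
apply: lt_le_trans (sqmass_ge x v).
by rewrite mulr_gt0 ?mass_gt0// lt_def sqrf_eq0 xv sqr_ge0.
Qed.

Lemma sqmassZ a x : sqmass (fun v => a * x v) = a ^+ 2 * sqmass x.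
Proof. by rewrite !sqmassE mulr_sumr; apply: eq_bigr => v _; ring. Qed.

(** From [a <= 1 + a ^+ 2]: crude, but enough to confine sublevel sets to boxes. *)
Lemma sqmass_bound x v c : sqmass x <= c -> `|x v| <= 1 + c / mass G v.
Proof.
move=> xc; have m0 := mass_gt0 G v.
have : x v ^+ 2 <= c / mass G v.
  by rewrite ler_pdivlMr// mulrC (le_trans (sqmass_ge x v)).
rewrite -real_normK ?num_real//.
move: (`|x v|) (normr_ge0 (x v)) (c / _) => a a0 b ab; nra.
Qed.

(** * Energy minimisers and potentials relative to the boundary *)

Section Boundary.
Variable S : {set V}.
Hypothesis conG : connected_graph G.
Hypothesis S_neq0 : S != finset.set0.

(** The quotient is scale invariant, so it is minimised on the bounded closed set [sqmass x = 1].
    With the denominator cleared, the bound also covers [x = 0]. *)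
Lemma rayleigh_minimizer : S \proper finset.setT ->
  exists m : V -> R, [/\ forall v, v \in S -> m v = 0, m <> (fun=> 0) &
    forall x, (forall v, v \in S -> x v = 0) ->
      'E(m, m) / sqmass m * sqmass x <= 'E(x, x)].
Proof.
move=> /properP[_ [w _ wS]].
have normalise x : x <> (fun=> 0) ->
    sqmass (fun v => (Num.sqrt (sqmass x))^-1 * x v) = 1.
  move=> /sqmass_gt0 x0; rewrite sqmassZ exprVn sqr_sqrtr ?ltW//.
  by rewrite mulVf ?gt_eqF.
pose C := ([set x : {ptws V -> R} | forall v, v \in S -> x v = 0] `&`
           [set x : {ptws V -> R} | sqmass x = 1])%classic.
pose e v : R := (v == w)%:R.
have e0 : e <> (fun=> 0).
  by move/(congr1 (@^~ w)); rewrite /e eqxx => /eqP; rewrite oner_eq0.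
pose x0 v := (Num.sqrt (sqmass e))^-1 * e v.
have [||||m [mS m1] mP] := @coercive_minimizer R V (qform (laplacian G)) C x0
    (\sum_v (1 + 1 / mass G v)).
- exact: continuous_qform.
- apply: closedI; first exact: closed_coord_eq.
  by apply: closed_level; exact: continuous_qform.
- split => [v vS|]; last exact: normalise.
  by rewrite /x0 /e; case: eqP => [vw|]; rewrite ?mulr0//; rewrite vw (negbTE wS) in vS.
- move=> x [_ x1] _ v; apply: (@le_trans _ _ (1 + 1 / mass G v)).
    by apply: sqmass_bound; rewrite x1.
  rewrite (bigD1 v)//= lerDl sumr_ge0// => u _.
  by rewrite addr_ge0// divr_ge0 ?(ltW (mass_gt0 _ _)).
exists m; split => //.
  move=> m0; move: m1 => /= /eqP.
  by rewrite m0 sqmassE big1 1?eq_sym ?oner_eq0// => v _; rewrite expr0n mulr0.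
move=> x xS; rewrite m1 divr1.
have [->|x0'] := pselect (x = (fun=> 0)).
  by rewrite sqmassE big1 ?mulr0 ?dirichlet_ge0// => v _; rewrite expr0n mulr0.
have := mP (fun v => (Num.sqrt (sqmass x))^-1 * x v).
rewrite !qform_dirichlet dirichletZ dirichletC dirichletZ mulrA -expr2 exprVn.
have gt0 := sqmass_gt0 x0'.
rewrite sqr_sqrtr ?(ltW gt0)// mulrC ler_pdivlMr//; apply.
by split => [v vS|]; [rewrite xS ?mulr0|exact: normalise].
Qed.

(** The constant is the least Rayleigh quotient: were it 0, a minimiser would be constant, hence 0
    because it vanishes on [S]. This gives the coercivity needed for potentials. *)
Lemma poincare : exists2 c, 0 < c &
  forall x, (forall v, v \in S -> x v = 0) -> c * sqmass x <= 'E(x, x).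
Proof.
have [s sS] := set0Pn _ S_neq0.
have [ST|] := boolP (S \proper finset.setT); last first.
  rewrite properT negbK => /eqP ST; exists 1 => // x xS.
  rewrite mul1r sqmassE big1 ?dirichlet_ge0// => v _.
  by rewrite xS ?ST ?inE// expr0n mulr0.
have [m [mS m0 mP]] := rayleigh_minimizer ST.
exists ('E(m, m) / sqmass m) => //; rewrite divr_gt0 ?sqmass_gt0//.
rewrite lt_def dirichlet_ge0 andbT; apply/eqP => Em0; apply: m0.
by apply/funext => v; rewrite (dirichlet_eq0 conG Em0 v s) mS.
Qed.

Lemma capacity_minimizer A : [disjoint A & S]%B ->
  exists p : V -> R, [/\ forall v, v \in A -> p v = 1,
    forall v, v \in S -> p v = 0 &
    forall x, (forall v, v \in A -> x v = 1) ->
      (forall v, v \in S -> x v = 0) -> 'E(p, p) <= 'E(x, x)].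
Proof.
move=> dAS; have [c c0 cP] := poincare.
pose x0 v : R := (v \in A)%:R.
have [||||p [pA pS] pP] := @coercive_minimizer R V (qform (laplacian G))
    ([set x : {ptws V -> R} | forall v, v \in A -> x v = 1] `&`
     [set x : {ptws V -> R} | forall v, v \in S -> x v = 0])%classic x0
    (\sum_v (1 + 'E(x0, x0) / c / mass G v)).
- exact: continuous_qform.
- by apply: closedI; exact: closed_coord_eq.
- split => v; first by rewrite /x0 => ->.
  by rewrite /x0; case: (boolP (v \in A)) => // vA; rewrite (disjointFr dAS vA).
- move=> x [_ xS]; rewrite !qform_dirichlet => xx0 v.
  apply: (@le_trans _ _ (1 + 'E(x0, x0) / c / mass G v)).
    apply: sqmass_bound; rewrite ler_pdivlMr// mulrC.
    exact: le_trans (cP x xS) xx0.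
  rewrite (bigD1 v)//= lerDl sumr_ge0// => u _.
  by rewrite addr_ge0// !divr_ge0 ?dirichlet_ge0 ?(ltW c0) ?(ltW (mass_gt0 _ _)).
exists p; split => // x xA xS; rewrite -!qform_dirichlet.
exact: pP.
Qed.

(** The last clause is one-sided first-order optimality: raising [p] on [A] cannot lower the energy
    to first order. *)
Definition equilibrium A (p : V -> R) : Prop :=
  [/\ forall v, v \in A -> p v = 1,
    forall v, v \in S -> p v = 0,
    forall x, (forall v, v \in A -> x v = 1) ->
      (forall v, v \in S -> x v = 0) -> 'E(p, p) <= 'E(x, x) &
    forall z, (forall v, v \in A -> 0 <= z v) ->
      (forall v, v \in S -> z v = 0) -> 0 <= 'E(p, z)].

(* Truncating [p + a z] at height 1 yields an admissible competitor of no larger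
   energy, so the first variation of the energy at [p] along [z] is nonnegative. *)
Lemma equilibrium_potential A : [disjoint A & S]%B ->
  exists p : V -> R, equilibrium A p.
Proof.
move=> /capacity_minimizer[p [pA pS pP]]; exists p; split => // z zA zS.
have key a : 0 < a -> 0 <= 2 * 'E(p, z) + a * 'E(z, z).
  move=> a0; pose x v := p v + a * z v.
  have : 'E(p, p) <= 'E(x, x).
    apply: (@le_trans _ _ 'E(fun v => Num.min (x v) 1, fun v => Num.min (x v) 1)).
      apply: pP => v vB; rewrite /x.
        by apply: min_r; rewrite pA// lerDl mulr_ge0 ?(ltW a0)// zA.
      by rewrite pS// zS// mulr0 addr0; apply: min_l.
    apply: (dirichlet_contraction (f := Num.min^~ 1)) => b c.
    rewrite !minEle ler_norml; move: (ler_norm (b - c)) (ler_norm (c - b)).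
    rewrite (distrC c b) => ? ?.
    by case: (leP b 1) => ?; case: (leP c 1) => ?; lra.
  rewrite dirichlet_sqrD -addrA lerDl => h.
  rewrite -(pmulr_rge0 _ a0); lra.
rewrite leNgt; apply/negP => Epz0.
have Ez0 := dirichlet_ge0 z.
have d0 : 0 < 'E(z, z) + 1 by lra.
(* This step is short enough for the negative linear term to dominate; the added 1 keeps the
   denominator positive. *)
have := key (- 'E(p, z) / ('E(z, z) + 1)) _.
rewrite divr_gt0 ?oppr_gt0// => /(_ isT).
rewrite -(pmulr_rge0 _ d0).
have -> : ('E(z, z) + 1) *
    (2 * 'E(p, z) + - 'E(p, z) / ('E(z, z) + 1) * 'E(z, z)) =
  'E(p, z) * ('E(z, z) + 2) by field; lra.
by rewrite leNgt nmulr_rlt0//; lra.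
Qed.

(** * Layered potentials and the capacitary inequality *)

Section Levels.
Variables (pot : {set V} -> V -> R) (x : V -> R) (t : nat -> R) (k : nat).
Hypothesis potP : forall A, [disjoint A & S]%B -> equilibrium A (pot A).
Hypothesis xS : forall v, v \in S -> x v = 0.
Hypothesis t0 : t 0%N = 0.
Hypothesis t_homo : {homo t : i j / (i <= j)%N >-> i <= j}.
Hypothesis x_level : forall v, exists2 j, (j <= k)%N & x v = t j.

Let A i : {set V} := [set v | t i < x v]%SET.
Let c i := 'E(pot (A i), pot (A i)).
Let P n v := \sum_(i < n) (t i.+1 - t i) * pot (A i) v.

Lemma level_disjoint i : [disjoint A i & S]%B.
Proof.
rewrite disjoint_sym disjoint_subset; apply/fintype.subsetP => v vS.
by rewrite !inE xS// -leNgt -t0 t_homo.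
Qed.

Lemma pot1 i v : v \in A i -> pot (A i) v = 1.
Proof. by case: (potP (level_disjoint i)) => + _ _ _; apply. Qed.

Lemma pot0 i v : v \in S -> pot (A i) v = 0.
Proof. by case: (potP (level_disjoint i)) => _ + _ _; apply. Qed.

(** First-order optimality is applied to [z - a * pot (A i)]. *)
Lemma potential_ge i a z : (forall v, v \in A i -> a <= z v) ->
  (forall v, v \in S -> z v = 0) -> a * c i <= 'E(pot (A i), z).
Proof.
move=> zA zS; have [_ _ _ pot_ge0] := potP (level_disjoint i).
have := pot_ge0 (fun v => z v + (- a) * pot (A i) v).
rewrite dirichletD mulNr subr_ge0; apply => v vB.
  by rewrite pot1// mulr1 subr_ge0 zA.
by rewrite pot0// zS// mulr0 addr0.
Qed.

Lemma potential_eq i a z : (forall v, v \in A i -> z v = a) ->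
  (forall v, v \in S -> z v = 0) -> 'E(pot (A i), z) = a * c i.
Proof.
move=> zA zS; apply/eqP; rewrite eq_le potential_ge ?andbT; first last.
- exact: zS.
- by move=> v /zA ->.
have := @potential_ge i (- a) (fun v => (-1) * z v).
rewrite dirichletZ mulN1r mulNr lerN2; apply => v vB.
  by rewrite zA// mulN1r.
by rewrite zS// mulr0.
Qed.

Lemma telescope_level n : \sum_(i < n) (t i.+1 - t i) = t n.
Proof. rewrite -(big_mkord xpredT (fun i => t i.+1 - t i)).
by rewrite telescope_sumr// t0 subr0. Qed.

(** The sets [A i] decrease, so [P n] equals [t n] on [A n] and the new cross term is exact. With
    [d = t n.+1 - t n], the increment is [(2 * d * t n + d ^+ 2) * c n]. *)
Lemma dirichlet_layers n :
  'E(P n, P n) = \sum_(i < n) (t i.+1 ^+ 2 - t i ^+ 2) * c i.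
Proof.
elim: n => [|n IHn].
  rewrite big_ord0; apply: big1 => e _.
  by rewrite /P !big_ord0 subrr mul0r mulr0.
rewrite big_ord_recr -IHn /=.
have -> : P n.+1 = (fun v => P n v + (t n.+1 - t n) * pot (A n) v).
  by apply/funext => v; rewrite /P big_ord_recr.
rewrite dirichlet_sqrD (dirichletC (P n)) (@potential_eq n (t n)).
- by rewrite -/(c n); ring.
- move=> v vA; rewrite -[RHS]telescope_level; apply: eq_bigr => i _.
  rewrite pot1 ?mulr1//; move: vA; rewrite !inE; apply: le_lt_trans.
  by rewrite t_homo// ltnW.
- by move=> v vS; apply: big1 => i _; rewrite pot0 ?mulr0.
Qed.

(** On [A n] the value of [x] is some [t j] with [j > n], hence at least [t n.+1]. *)
Lemma dirichlet_layers_ge n :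
  \sum_(i < n) (t i.+1 - t i) * t i.+1 * c i <= 'E(x, P n).
Proof.
elim: n => [|n IHn].
  rewrite big_ord0 /dirichlet_form big1// => e _.
  by rewrite /P !big_ord0 subrr !mulr0.
rewrite big_ord_recr /=.
have -> : P n.+1 = (fun v => P n v + (t n.+1 - t n) * pot (A n) v).
  by apply/funext => v; rewrite /P big_ord_recr.
rewrite dirichletD lerD// -mulrA ler_wpM2l ?subr_ge0 ?t_homo// dirichletC.
apply: potential_ge => // v; rewrite !inE.
have [j _ ->] := x_level v.
by case: (ltnP n j) => [nj _|jn]; [exact: t_homo|rewrite le_gtF// t_homo].
Qed.

(* [2 E(x, P) >= E(P, P)], whence the claim by expanding [E(2x - P, 2x - P) >= 0]. *)
Lemma capacitary_inequality n :
  \sum_(i < n) (t i.+1 ^+ 2 - t i ^+ 2) * c i <= 4 * 'E(x, x).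
Proof.
rewrite -dirichlet_layers.
have half : 'E(P n, P n) <= 2 * 'E(x, P n).
  rewrite dirichlet_layers.
  apply: (@le_trans _ _ (2 * \sum_(i < n) (t i.+1 - t i) * t i.+1 * c i)).
    rewrite mulr_sumr; apply: ler_sum => i _; rewrite !mulrA.
    rewrite ler_wpM2r ?dirichlet_ge0// -subr_ge0.
    (* The two coefficients differ by exactly this square. *)
    have := sqr_ge0 (t i.+1 - t i); lra.
  by rewrite ler_pM2l// dirichlet_layers_ge.
have := dirichlet_ge0 (fun v => x v + (- 2^-1) * P n v).
rewrite dirichlet_sqrD; lra.
Qed.

(** After exchanging sums, a vertex at level [t j] collects the layers [i < j], which telescope to
    [t j ^+ 2]. *)
Lemma sqmass_layers :
  sqmass x = \sum_(i < k) (t i.+1 ^+ 2 - t i ^+ 2) * mu G (A i).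
Proof.
rewrite sqmassE.
under [RHS]eq_bigr do rewrite /mu big_mkcond mulr_sumr.
rewrite exchange_big; apply: eq_bigr => v _ /=.
have [j jk xv] := x_level v.
pose F i := if (i < j)%N then mass G v * (t i.+1 ^+ 2 - t i ^+ 2) else 0.
rewrite [RHS](eq_bigr (fun i : 'I_k => F i)) => [|i _]; last first.
  rewrite inE xv /F; case: (ltnP i j) => ij.
    (* Levels may repeat: if [t j <= t i], the vertex is outside [A i], but that layer has zero
       width. *)
    case: (ltP (t i) (t j)) => [_|tji]; first by rewrite mulrC.
    have -> : t i.+1 = t i.
      apply: le_anti; rewrite (@t_homo i i.+1)// andbT.
      by apply: le_trans tji; exact: t_homo.
    by rewrite subrr !mulr0.
  by rewrite le_gtF ?t_homo// mulr0.
rewrite -big_mkcond -(big_ord_widen_cond _ xpredT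
  (fun i => mass G v * (t i.+1 ^+ 2 - t i ^+ 2)))// -mulr_sumr.
rewrite -(big_mkord xpredT (fun i => t i.+1 ^+ 2 - t i ^+ 2)).
by rewrite (telescope_sumr (fun i => t i ^+ 2))// t0 expr0n subr0 xv.
Qed.

End Levels.

Lemma levels x : (forall v, 0 <= x v) ->
  exists t : nat -> R, exists k, [/\ t 0%N = 0,
    {homo t : i j / (i <= j)%N >-> i <= j} &
    forall v, exists2 j, (j <= k)%N & x v = t j].
Proof.
move=> x0; pose s := sort <=%R [seq x v | v : V].
pose top := \sum_v x v.
have s_mem (y : R) : y \in s -> exists v, y = x v.
  by rewrite mem_sort => /codomP.
have s_ge0 (y : R) : y \in 0 :: s -> 0 <= y.
  by rewrite inE => /predU1P[->//|/s_mem[v ->]].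
have s_top (y : R) : y \in 0 :: s -> y <= top.
  rewrite inE => /predU1P[->|/s_mem[v ->]]; first exact: sumr_ge0.
  by rewrite /top (bigD1 v)//= lerDl sumr_ge0.
have s_sorted : sorted <=%R (0 :: s).
  rewrite /= path_min_sorted; first exact: (sort_sorted le_total).
  by apply/allP => y ys; apply: s_ge0; rewrite inE ys orbT.
(* The default [top] bounds all values, so the sequence stays nondecreasing past the end of the
   list. The leading 0 shifts indices by one. *)
exists (nth top (0 :: s)), (size s); split => // [i j ij|v].
  case: (ltnP j (size (0 :: s))) => js.
    apply: (sorted_leq_nth le_trans le_refl) => //.
    by rewrite inE (leq_ltn_trans ij).
  rewrite [leRHS]nth_default//.
  case: (ltnP i (size (0 :: s))) => is_; last by rewrite nth_default.
  exact/s_top/mem_nth.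
have : x v \in s by rewrite mem_sort; exact: codom_f.
by move=> /(nthP top)[i is_ <-]; exists i.+1.
Qed.

(** * Eigenvalue, conductance and content as attained minima *)

Lemma dirichlet_eigenvalueP : S \proper finset.setT ->
  exists m : V -> R, [/\ forall v, v \in S -> m v = 0, 0 < sqmass m,
    dirichlet_eigenvalue G S = 'E(m, m) / sqmass m &
    forall x, (forall v, v \in S -> x v = 0) ->
      dirichlet_eigenvalue G S * sqmass x <= 'E(x, x)].
Proof.
move=> /rayleigh_minimizer[m [mS m0 mP]].
have lE : dirichlet_eigenvalue G S = 'E(m, m) / sqmass m.
  apply: minimumE; split; first by exists m; rewrite qform_dirichlet.
  move=> _ [x [xS x0 ->]].
  rewrite qform_dirichlet ler_pdivlMr ?sqmass_gt0//; exact: mP.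
by exists m; split => //; [exact: sqmass_gt0|rewrite lE].
Qed.

(** The resistance asks for 1 on [S] and 0 on [A]; replacing [x] by [1 - x] swaps these values and
    keeps the energy. *)
Lemma effective_conductance A (p : V -> R) :
  (forall v, v \in A -> p v = 1) -> (forall v, v \in S -> p v = 0) ->
  (forall x, (forall v, v \in A -> x v = 1) ->
      (forall v, v \in S -> x v = 0) -> 'E(p, p) <= 'E(x, x)) ->
  (effective_resistance G S A)^-1 = 'E(p, p).
Proof.
move=> pA pS pP; rewrite invrK; apply: minimumE; split.
  exists (fun v => 1 - p v); split => [v /pS ->|v /pA ->|].
  - by rewrite subr0.
  - by rewrite subrr.
  - by rewrite qform_dirichlet dirichlet_flip.
move=> _ [x [xS xA ->]]; rewrite qform_dirichlet -(dirichlet_flip x).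
by apply: pP => v; [move=> /xA ->; rewrite subr0|move=> /xS ->; rewrite subrr].
Qed.

Lemma mu_gt0 A : A != finset.set0 -> 0 < mu G A.
Proof.
move=> /set0Pn[v vA]; rewrite /mu (bigD1 v)//= ltr_wpDr ?mass_gt0//.
by apply: sumr_ge0 => u _; rewrite ltW ?mass_gt0.
Qed.

Lemma dirichlet_contentP : S \proper finset.setT ->
  exists A, [/\ A != finset.set0, [disjoint A & S]%B,
    dirichlet_content G S = (effective_resistance G S A)^-1 / mu G A &
    forall B, B != finset.set0 -> [disjoint B & S]%B ->
      dirichlet_content G S * mu G B <= (effective_resistance G S B)^-1].
Proof.
move=> /properP[_ [w _ wS]].
pose ok A := (A != finset.set0) && [disjoint A & S]%B.
have ok0 : ok (~: S).
  rewrite /ok finset.disjoints_subset subxx andbT.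
  by apply/set0Pn; exists w; rewrite inE.
have [A /andP[A0 AS] AP] :=
  arg_minP (fun A => (effective_resistance G S A)^-1 / mu G A) ok0.
have psiE : dirichlet_content G S = (effective_resistance G S A)^-1 / mu G A.
  apply: minimumE; split; first by exists A.
  by move=> _ [B [B0 BS ->]]; apply: AP; rewrite /ok B0.
exists A; split => // B B0 BS; rewrite -ler_pdivlMr ?mu_gt0// psiE.
by apply: AP; rewrite /ok B0.
Qed.

(** * The two inequalities between eigenvalue and content *)

Lemma content_inequality x : S \proper finset.setT ->
  (forall v, v \in S -> x v = 0) ->
  dirichlet_content G S * sqmass x <= 4 * 'E(x, x).
Proof.
move=> ST xS; have [_ [_ _ _ psiP]] := dirichlet_contentP ST.
(* The absolute value keeps the mass norm, does not raise the energy, and makes the level sets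
   available. *)
pose y v := `|x v|.
have -> : sqmass x = sqmass y.
  by rewrite !sqmassE; apply: eq_bigr => v _; rewrite real_normK ?num_real.
have yE : 'E(y, y) <= 'E(x, x).
  by apply: (dirichlet_contraction (f := Num.norm)) => a b; exact: ler_dist_dist.
apply: (@le_trans _ _ (4 * 'E(y, y))); last by rewrite ler_pM2l.
have yS v : v \in S -> y v = 0 by rewrite /y => /xS ->; rewrite normr0.
have [t [k [t0 t_homo y_level]]] := levels (fun v => normr_ge0 (x v)).
have /choice[pot potP] : forall A, exists p : V -> R,
    [disjoint A & S]%B -> equilibrium A p.
  move=> A; have [AS|_] := boolP [disjoint A & S]%B; last by exists (fun=> 0).
  by have [p pP] := equilibrium_potential AS; exists p.
apply: le_trans (capacitary_inequality potP yS t0 t_homo y_level k).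
rewrite (sqmass_layers t0 t_homo y_level) mulr_sumr; apply: ler_sum => i _.
rewrite mulrCA; apply: ler_wpM2l.
  have ti : 0 <= t i by rewrite -t0 t_homo.
  by rewrite subr_ge0 lerXn2r ?nnegrE ?t_homo// (le_trans ti) ?t_homo.
set A := [set v | _]%SET.
(* The content ranges over nonempty sets only; an empty layer has mass 0. *)
have [->|A0] := eqVneq A finset.set0.
  by rewrite /mu big_set0 mulr0 dirichlet_ge0.
have AS : [disjoint A & S]%B by exact: (level_disjoint yS t0 t_homo).
have [pA pS pP _] := potP A AS.
by rewrite -(effective_conductance pA pS pP) psiP.
Qed.

Lemma eigenvalue_le_content : S \proper finset.setT ->
  dirichlet_eigenvalue G S <= dirichlet_content G S.
Proof.
move=> ST; have [_ [_ _ _ lP]] := dirichlet_eigenvalueP ST.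
have [A [A0 AS -> _]] := dirichlet_contentP ST.
have [p [pA pS pP]] := capacity_minimizer AS.
rewrite (effective_conductance pA pS pP) ler_pdivlMr ?mu_gt0//.
have p0 : 0 < sqmass p.
  have [v vA] := set0Pn _ A0; apply: lt_le_trans (sqmass_ge p v).
  by rewrite pA// expr1n mulr1 mass_gt0.
(* Comparing [mu G A] with [sqmass p] under the factor of the eigenvalue requires that factor to be
   nonnegative. *)
apply: le_trans (lP p pS); apply: ler_wpM2l.
  have [m [_ m0 -> _]] := dirichlet_eigenvalueP ST.
  by rewrite divr_ge0 ?dirichlet_ge0 ?(ltW m0).
rewrite sqmassE /mu big_mkcond; apply: ler_sum => v _.
case: ifPn => [/pA ->|_]; first by rewrite expr1n mulr1.
by rewrite mulr_ge0 ?sqr_ge0 ?(ltW (mass_gt0 _ _)).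
Qed.

End Boundary.
End Energy.

Theorem theorem5 (R : realType) (V : finType) (G : wgraph R V) (S : {set V})
  (G_connected : connected_graph G)
  (S_neq0 : S != finset.set0) (S_proper : S \proper finset.setT) :
  dirichlet_content G S / 4 <= dirichlet_eigenvalue G S /\
  dirichlet_eigenvalue G S <= dirichlet_content G S.
Proof.
split; last exact: eigenvalue_le_content.
have [m [mS m0 -> _]] := dirichlet_eigenvalueP G S_proper.
(* Clearing denominators leaves the content inequality at the Rayleigh minimiser [m]. *)
rewrite ler_pdivlMr// mulrAC ler_pdivrMr// [leRHS]mulrC.
exact: content_inequality.
Qed.
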